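(* For any point $\mathbf{w} \in \prod_{i=1}^r \Delta \mathcal{P}_i$, and proofs $\zeta, \rho \in \mathcal{P}_i$, \[ [\![\psi]\!]\Big( |\emptyset\rangle_{[\![w_1]\!]} \otimes \cdots \otimes \big| [\![\zeta]\!] - [\![\rho]\!] \big\rangle_{[\![w_i]\!]} \otimes \cdots \otimes |\emptyset\rangle_{[\![w_r]\!]} \Big) = T_{\mathbf{w}}( \Delta \psi )( B^\zeta_{\rho} ) \] where we identify the right hand side as a vector in $[\![B]\!]$ using the inclusions \begin{gather*} T_{\Delta \psi(\mathbf{w})}(\Delta \mathcal{Q}) \hookrightarrow T_{\Delta \psi(\mathbf{w})}( \mathbb{R} \mathcal{Q} ) \cong \mathbb{R} \mathcal{Q} \hookrightarrow [\![B]\!]\,, \\ B^{\tau}_{\theta} \longmapsto [\![\tau]\!] - [\![\theta]\!]\,. \end{gather*}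
   Context: $k=\mathbb{C}$ and $[\![-]\!]$ is the Sweedler semantics of linear logic, ${!}V$ the cofree cocommutative coalgebra with kets $|w\rangle_v$ and vacuum $|\emptyset\rangle_v$. $\psi: {!} A_1, \ldots, {!} A_r \vdash B$ is a plain proof built from $\pi: n_1A_1,\ldots,n_rA_r\vdash B$ by derelictions and contractions/weakenings; $\mathcal{P}_i$ are finite sets of proofs of $A_i$ and $\mathcal{Q}$ a finite set of proofs of $B$ with linearly independent denotations containing all $\pi(X_1,\ldots,X_r)$, $X_i\in\mathcal{P}_i^{n_i}$. $\Delta\mathcal{P}\subseteq\mathbb{R}\mathcal{P}$ is the simplex of probability distributions, a manifold with corners whose tangent space at a point is that of the affine hull $\{\sum\lambda_\rho\rho : \sum\lambda_\rho = 1\}$. $\Delta\psi: \prod_i\Delta\mathcal{P}_i\to\Delta\mathcal{Q}$ is the naive probabilistic extension, the unique function with $[\![\psi]\!](\otimes_i|\emptyset\rangle_{[\![v_i]\!]}) = [\![\Delta\psi(v_1,\ldots,v_r)]\!]$; it is the restriction of the polynomial map with components $f^\tau_\psi = \sum_{\gamma_1,\ldots,\gamma_r} \delta_{\tau = \pi(\rho_{\gamma_1},\ldots,\rho_{\gamma_r})} \prod_{i}\prod_{j=1}^{n_i} x^i_{\gamma_i(j)}$, hence smooth. With coordinates $x^i_\rho$ on $\mathbb{R}\mathcal{P}_i$, $B^\zeta_\rho = \frac{\partial}{\partial x^i_\zeta} - \frac{\partial}{\partial x^i_\rho}$ is a tangent vector in $T_{\mathbf{w}}(\prod_i\Delta\mathcal{P}_i)$;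 on $\Delta\mathcal{Q}$ the vectors $B^\tau_\theta$ are defined analogously. *)

(* Defs.v *)
From HB Require Import structures.
From mathcomp Require Import all_boot all_order all_algebra.
From mathcomp Require Import generic_quotient ring_quotient.
From mathcomp Require Import all_classical all_reals all_analysis.
From mathcomp Require Import complex freeg.

Set Implicit Arguments.
Unset Strict Implicit.
Unset Printing Implicit Defensive.

Import GRing.Theory Num.Theory numFieldNormedType.Exports.
Local Open Scope classical_set_scope.
Local Open Scope ring_scope.
Local Open Scope quotient_scope.

Section Hom.
Context (K : fieldType) (U V : lmodType K).

Definition is_linear_map : {pred U -> V} := fun f => `[< linear f >].

Record hom := Hom { hom_fun :> U -> V; hom_funP : hom_fun \in is_linear_map }.

HB.instance Definition _ := [isSub for hom_fun].
HB.instance Definition _ := [Choice of hom by <:].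


Fact is_linear_map_closed : submod_closed is_linear_map.
Proof.
split; first by apply/asboolP => a u v; rewrite /= scaler0 addr0.
move=> a f g /asboolP lf /asboolP lg; apply/asboolP => b u v.
have E (w : U) : (a *: f + g) w = a *: f w + g w by [].
by rewrite !E lf lg !scalerDr !scalerA mulrC addrACA.
Qed.

HB.instance Definition _ :=
  GRing.isSubmodClosed.Build K (U -> V) is_linear_map is_linear_map_closed.
HB.instance Definition _ := [SubChoice_isSubLmodule of hom by <:].

Lemma hom_linear (f : hom) : linear f.
Proof. by case: f => f /= /asboolP. Qed.

HB.instance Definition _ (f : hom) :=
  GRing.isLinear.Build K U V _ f (hom_linear f).

Definition hom_of (f : {linear U -> V}) : hom :=
  Hom (introT (asboolP _) (linearP f) : (f : U -> V) \in is_linear_map).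

Lemma hom_eqP (f g : hom) : f =1 g -> f = g.
Proof. by move=> fg; apply/val_inj/funext. Qed.

Lemma hom_addE (f g : hom) u : (f + g) u = f u + g u.
Proof. by []. Qed.

Lemma hom_scaleE a (f : hom) u : (a *: f) u = a *: f u.
Proof. by []. Qed.

End Hom.
Arguments hom {K}.
Arguments hom_of {K U V}.
Arguments Hom {K U V}.

Section Tensor.
Context (K : fieldType) (U V : lmodType K).

(* [tensor U V] is the free module on [U * V] modulo the submodule generated
   by the bilinearity relators *)
Inductive bilinear_relator : {freeg (U * V) / K} -> Prop :=
| BilinearRelatorL a u1 u2 v :
    bilinear_relator (<< (a *: u1 + u2, v) >> - a *: << (u1, v) >> - << (u2, v) >>)
| BilinearRelatorR a u v1 v2 :
    bilinear_relator (<< (u, a *: v1 + v2) >> - a *: << (u, v1) >> - << (u, v2) >>).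

Definition bilinear_relations : {pred {freeg (U * V) / K}} := fun x =>
  `[< forall S : set {freeg (U * V) / K},
        S 0 -> (forall a y z, S y -> S z -> S (a *: y + z)) ->
        bilinear_relator `<=` S -> S x >].

Fact bilinear_relations_closed : submod_closed bilinear_relations.
Proof.
split; first by apply/asboolP => S.
move=> a x y /asboolP Rx /asboolP Ry; apply/asboolP => S S0 SD relS.
by apply: (SD); [exact: Rx | exact: Ry].
Qed.

HB.instance Definition _ :=
  GRing.isSubmodClosed.Build K {freeg (U * V) / K} bilinear_relations
    bilinear_relations_closed.

Definition tensor := {ideal_quot bilinear_relations}.

HB.instance Definition _ := GRing.Zmodule.on tensor.

Definition tensor_pi (x : {freeg (U * V) / K}) : tensor :=
  \pi_({ideal_quot bilinear_relations}) x.

Definition tensor_repr (x : tensor) : {freeg (U * V) / K} :=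
  repr (x : {ideal_quot bilinear_relations}).

Fact tensor_reprK : cancel tensor_repr tensor_pi.
Proof. exact: reprK. Qed.

Fact tensor_pi_eq x y :
  (tensor_pi x = tensor_pi y) <-> x - y \in bilinear_relations.
Proof. by rewrite Quotient.idealrBE; split=> [/eqP|/eqP]. Qed.

Fact tensor_piD x y : tensor_pi (x + y) = tensor_pi x + tensor_pi y.
Proof. exact: raddfD. Qed.

Definition tensor_scale a (x : tensor) : tensor :=
  tensor_pi (a *: tensor_repr x).

Fact tensor_scaleE a x : tensor_scale a (tensor_pi x) = tensor_pi (a *: x).
Proof.
apply/tensor_pi_eq; rewrite -scalerBr rpredZ//.
by apply/tensor_pi_eq; rewrite tensor_reprK.
Qed.

Fact tensor_scaleA a b x :
  tensor_scale a (tensor_scale b x) = tensor_scale (a * b) x.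
Proof. by rewrite -[x]tensor_reprK !tensor_scaleE scalerA. Qed.

Fact tensor_scale1 : left_id 1 tensor_scale.
Proof. by move=> x; rewrite -[x]tensor_reprK tensor_scaleE scale1r. Qed.

Fact tensor_scaleDr : right_distributive tensor_scale +%R.
Proof.
move=> a x y; rewrite -[x]tensor_reprK -[y]tensor_reprK -tensor_piD.
by rewrite !tensor_scaleE scalerDr tensor_piD.
Qed.

Fact tensor_scaleDl x : {morph tensor_scale^~ x : a b / a + b}.
Proof.
by move=> a b; rewrite -[x]tensor_reprK !tensor_scaleE scalerDl tensor_piD.
Qed.

HB.instance Definition _ := GRing.Zmodule_isLmodule.Build K tensor
  tensor_scaleA tensor_scale1 tensor_scaleDr tensor_scaleDl.

Fact tensor_piZ a x : tensor_pi (a *: x) = a *: tensor_pi x.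
Proof. by rewrite -tensor_scaleE. Qed.

Definition pure (u : U) (v : V) : tensor := tensor_pi << (u, v) >>.

Lemma pure_linearl v : linear (pure^~ v).
Proof.
move=> a u1 u2; rewrite /pure -tensor_piZ -tensor_piD; apply/tensor_pi_eq.
apply/asboolP => S _ _; apply; rewrite opprD addrA; exact: BilinearRelatorL.
Qed.

Lemma pure_linearr u : linear (pure u).
Proof.
move=> a v1 v2; rewrite /pure -tensor_piZ -tensor_piD; apply/tensor_pi_eq.
apply/asboolP => S _ _; apply; rewrite opprD addrA; exact: BilinearRelatorR.
Qed.

Lemma tensor_ind (P : tensor -> Prop) :
  P 0 -> (forall a x y, P x -> P y -> P (a *: x + y)) ->
  (forall u v, P (pure u v)) -> forall x, P x.
Proof.
move=> P0 PD Ppure x; rewrite -[x]tensor_reprK -[tensor_repr x]freeg_sumE.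
elim: (dom _) => [|z s IHs].
  rewrite big_nil (_ : tensor_pi 0 = 0)//.
  by apply: (addrI (tensor_pi 0)); rewrite -tensor_piD !addr0.
rewrite big_cons tensor_piD (_ : << _ *g z >> = coeff z (tensor_repr x) *: << z >>).
  rewrite tensor_piZ; case: z => u v.
  exact: (PD _ _ _ (Ppure u v) IHs).
apply/eqP/freeg_eqP => w; rewrite coeffZ !coeffU mul1r //.
Qed.

Section Lift.
Context (W : lmodType K) (f : U -> V -> W).

Definition bilinear_map := (forall v, linear (f^~ v)) /\ (forall u, linear (f u)).

Definition tensor_lift (x : tensor) : W :=
  fglift (fun p => f p.1 p.2) (tensor_repr x).

Hypothesis f_bilin : bilinear_map.

Let phi := fglift (fun p : U * V => f p.1 p.2).

Let phi0 : phi 0 = 0.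
Proof.
have := lift_is_additive (fun p : U * V => f p.1 p.2) 0 0.
by rewrite !subr0 -/phi subrr.
Qed.

Let phiB x y : phi (x - y) = phi x - phi y.
Proof. exact: lift_is_additive. Qed.

Let phiD x y : phi (x + y) = phi x + phi y.
Proof. by rewrite -[y]opprK phiB -[in RHS]sub0r phiB phi0 sub0r. Qed.

Let phiZ a x : phi (a *: x) = a *: phi x.
Proof.
rewrite -[x]freeg_sumE; elim: (dom _) => [|z s IHs].
  by rewrite !big_nil scaler0 !phi0 scaler0.
rewrite !big_cons scalerDr !phiD scalerDr IHs; congr (_ + _).
have -> : a *: << coeff z x *g z >> = << a * coeff z x *g z >>.
  by apply/eqP/freeg_eqP => w; rewrite coeffZ !coeffU mulrA.
by rewrite /phi !liftU scalerA.
Qed.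

Fact tensor_liftE x : tensor_lift (tensor_pi x) = phi x.
Proof.
apply/eqP; rewrite -subr_eq0 -phiB; apply/eqP.
have /tensor_pi_eq/asboolP/(_ [set y | phi y = 0]) := tensor_reprK (tensor_pi x).
apply.
- exact: phi0.
- by move=> a y z /= hy hz; rewrite phiD phiZ hy hz scaler0 addr0.
- move=> _ [a u1 u2 v|a u v1 v2] /=; rewrite !phiB phiZ /phi !liftU !scale1r.
  + by rewrite (f_bilin.1 v) /= addrAC addrK subrr.
  + by rewrite (f_bilin.2 u) /= addrAC addrK subrr.
Qed.

Lemma tensor_lift_pure u v : tensor_lift (pure u v) = f u v.
Proof. by rewrite tensor_liftE /phi liftU scale1r. Qed.

Lemma tensor_lift_linear : linear tensor_lift.
Proof.
move=> a x y; rewrite -[x]tensor_reprK -[y]tensor_reprK.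
by rewrite -tensor_piZ -tensor_piD !tensor_liftE phiD phiZ.
Qed.

Lemma tensor_universal :
  {g : {linear tensor -> W} | forall u v, g (pure u v) = f u v}.
Proof.
exists (HB.pack_for {linear tensor -> W} tensor_lift
  (GRing.isLinear.Build K tensor W _ tensor_lift tensor_lift_linear)).
exact: tensor_lift_pure.
Qed.

Definition tlift : {linear tensor -> W} := sval tensor_universal.

Lemma tliftE u v : tlift (pure u v) = f u v.
Proof. exact: (svalP tensor_universal). Qed.

End Lift.

Lemma tensor_ext (W : lmodType K) (f g : {linear tensor -> W}) :
  (forall u v, f (pure u v) = g (pure u v)) -> f =1 g.
Proof.
move=> fg; elim/tensor_ind => [|a x y IHx IHy|//]; first by rewrite !linear0.
by rewrite !linearP IHx IHy.
Qed.

End Tensor.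
Arguments tensor {K}.
Arguments pure {K U V}.
Arguments bilinear_map {K U V W}.
Arguments tlift {K U V W f}.

Section TensorMaps.
Context (K : fieldType).
Implicit Types U V W Z : lmodType K.

Lemma linear_param U V W Z (F : W -> {linear tensor U V -> Z}) :
  (forall u v, linear (fun w => F w (pure u v))) ->
  forall x, linear (fun w => F w x).
Proof.
move=> Flin x a w1 w2; elim/tensor_ind: x => [|b x y IHx IHy|u v].
- by rewrite !linear0 addr0.
- rewrite !linearP IHx IHy !scalerDr !scalerA mulrC.
  by rewrite addrACA.
- exact: Flin.
Qed.

Fact tmap_bilinear U U' V V' (f : {linear U -> U'}) (g : {linear V -> V'}) :
  bilinear_map (fun u v => pure (f u) (g v)).
Proof.
by split=> [v|u] a x y /=; rewrite linearP ?pure_linearl ?pure_linearr.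
Qed.

Definition tmap U U' V V' (f : {linear U -> U'}) (g : {linear V -> V'}) :
  {linear tensor U V -> tensor U' V'} := tlift (tmap_bilinear f g).

Fact tswap_bilinear U V : bilinear_map (fun (u : U) (v : V) => pure v u).
Proof. by split=> [v|u] a x y /=; rewrite ?pure_linearl ?pure_linearr. Qed.

Definition tswap U V : {linear tensor U V -> tensor V U} :=
  tlift (@tswap_bilinear U V).

Fact tunitl_bilinear V : bilinear_map (fun (a : K^o) (v : V) => a *: v).
Proof.
split=> [v|u] a x y /=; first by rewrite scalerDl -scalerA.
by rewrite scalerDr !scalerA mulrC.
Qed.

Definition tunitl V : {linear tensor K^o V -> V} := tlift (@tunitl_bilinear V).

Definition tunitr V : {linear tensor V K^o -> V} :=
  @tunitl V \o @tswap V K^o.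

Fact tassoc_bilinear1 U V W (w : W) :
  bilinear_map (fun (u : U) (v : V) => pure u (pure v w)).
Proof.
split=> [v|u] a x y /=; first by rewrite pure_linearl.
by rewrite pure_linearl pure_linearr.
Qed.

Fact tassoc_bilinear U V W :
  bilinear_map (fun (x : tensor U V) (w : W) => tlift (@tassoc_bilinear1 _ _ _ w) x).
Proof.
split=> [w|]; first exact: linearP.
by apply: linear_param => u v a w1 w2; rewrite !tliftE !pure_linearr.
Qed.

Definition tassoc U V W :
    {linear tensor (tensor U V) W -> tensor U (tensor V W)} :=
  tlift (@tassoc_bilinear U V W).

Fact tassocV_bilinear1 U V W (u : U) :
  bilinear_map (fun (v : V) (w : W) => pure (pure u v) w).
Proof.
split=> [w|v] a x y /=; last by rewrite pure_linearr.
by rewrite pure_linearr pure_linearl.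
Qed.

Fact tassocV_bilinear U V W :
  bilinear_map (fun (u : U) (y : tensor V W) => tlift (@tassocV_bilinear1 _ _ _ u) y).
Proof.
split=> [|u]; last exact: linearP.
by apply: linear_param => v w a u1 u2; rewrite !tliftE !pure_linearl.
Qed.

Definition tassocV U V W :
    {linear tensor U (tensor V W) -> tensor (tensor U V) W} :=
  tlift (@tassocV_bilinear U V W).

(* the middle interchange (u (x) v) (x) (u' (x) v') |-> (u (x) u') (x) (v (x) v') *)
Fact tmid_bilinear1 U V U' V' (u : U) (v : V) :
  bilinear_map (fun (u' : U') (v' : V') => pure (pure u u') (pure v v')).
Proof.
by split=> [v'|u'] a x y /=; rewrite pure_linearr ?pure_linearl ?pure_linearr.
Qed.

Fact tmid_bilinear2 U V U' V' (y : tensor U' V') :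
  bilinear_map (fun (u : U) (v : V) => tlift (@tmid_bilinear1 _ _ _ _ u v) y).
Proof.
split=> [v|u].
- apply: (linear_param (F := fun u => tlift (@tmid_bilinear1 _ _ _ _ u v))) => u' v' a x z.
  by rewrite !tliftE !pure_linearl.
- apply: (linear_param (F := fun v => tlift (@tmid_bilinear1 _ _ _ _ u v))) => u' v' a x z.
  by rewrite !tliftE pure_linearl pure_linearr.
Qed.

Fact tmid_bilinear U V U' V' :
  bilinear_map (fun (x : tensor U V) (y : tensor U' V') =>
    tlift (@tmid_bilinear2 _ _ _ _ y) x).
Proof.
split=> [y|]; first exact: linearP.
apply: (linear_param (F := fun y => tlift (@tmid_bilinear2 _ _ _ _ y))) => u v a x z.
by rewrite !tliftE linearP.
Qed.

Definition tmid U V U' V' :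
    {linear tensor (tensor U V) (tensor U' V') ->
            tensor (tensor U U') (tensor V V')} :=
  tlift (@tmid_bilinear U V U' V').

Lemma tmapE U U' V V' (f : {linear U -> U'}) (g : {linear V -> V'}) u v :
  tmap f g (pure u v) = pure (f u) (g v).
Proof. exact: tliftE. Qed.

Lemma tswapE U V (u : U) (v : V) : tswap U V (pure u v) = pure v u.
Proof. exact: tliftE. Qed.

Lemma tunitlE V (a : K) (v : V) : tunitl V (pure (a : K^o) v) = a *: v.
Proof. exact: tliftE. Qed.

Lemma tunitrE V (a : K) (v : V) : tunitr V (pure v (a : K^o)) = a *: v.
Proof. by rewrite /tunitr /= tswapE tunitlE. Qed.

Lemma tassocE U V W (u : U) (v : V) (w : W) :
  tassoc U V W (pure (pure u v) w) = pure u (pure v w).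
Proof. by rewrite !tliftE. Qed.

Lemma tassocVE U V W (u : U) (v : V) (w : W) :
  tassocV U V W (pure u (pure v w)) = pure (pure u v) w.
Proof. by rewrite !tliftE. Qed.

Lemma tmidE U V U' V' (u : U) (v : V) (u' : U') (v' : V') :
  tmid U V U' V' (pure (pure u v) (pure u' v')) = pure (pure u u') (pure v v').
Proof. by rewrite !tliftE. Qed.

Fact teval_bilinear V W : bilinear_map (fun (v : V) (f : hom V W) => f v).
Proof. by split=> [f|v] a x y //=; rewrite linearP. Qed.

Definition teval V W : {linear tensor V (hom V W) -> W} :=
  tlift (@teval_bilinear V W).

Fact tcurry_linear1 U V W (f : {linear tensor U V -> W}) (v : V) :
  linear (fun u => f (pure u v)).
Proof. by move=> a x y; rewrite pure_linearl linearP. Qed.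

Definition tcurry1 U V W (f : {linear tensor U V -> W}) (v : V) : hom U W :=
  Hom (fun u => f (pure u v)) (introT (asboolP _) (tcurry_linear1 f v)).

Fact tcurry_linear U V W (f : {linear tensor U V -> W}) : linear (tcurry1 f).
Proof.
move=> a x y; apply: hom_eqP => u.
by rewrite hom_addE hom_scaleE /= pure_linearr linearP.
Qed.

Definition tcurry U V W (f : {linear tensor U V -> W}) : {linear V -> hom U W} :=
  HB.pack (tcurry1 f) (GRing.isLinear.Build K V (hom U W) _ _ (tcurry_linear f)).

Fact lpair_linear U V W (f : {linear U -> V}) (g : {linear U -> W}) :
  linear (fun u => (f u, g u)).
Proof. by move=> a x y; rewrite !linearP. Qed.

Definition lpair U V W (f : {linear U -> V}) (g : {linear U -> W}) :
    {linear U -> (V * W)%type} :=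
  HB.pack (fun u => (f u, g u))
    (GRing.isLinear.Build K U (V * W)%type _ _ (lpair_linear f g)).

Fact pure1_linear V : linear (fun v : V => pure (1 : K^o) v).
Proof. exact: pure_linearr. Qed.

Definition tunitlV V : {linear V -> tensor K^o V} :=
  HB.pack (fun v : V => pure (1 : K^o) v)
    (GRing.isLinear.Build K V (tensor K^o V) _ _ (@pure1_linear V)).

End TensorMaps.

Section Coalgebra.
Context (K : fieldType).

(* the right counit law follows from [counitl] and [cocomm] *)
Record coalgebra := Coalgebra {
  coalg_sort :> lmodType K;
  comul : {linear coalg_sort -> tensor coalg_sort coalg_sort};
  counit : {linear coalg_sort -> K^o};
  coassoc : forall x,
    tassoc _ _ _ (tmap comul idfun (comul x)) = tmap idfun comul (comul x);
  counitl : forall x, tunitl _ (tmap counit idfun (comul x)) = x;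
  cocomm : forall x, tswap _ _ (comul x) = comul x }.

Definition coalgebra_morphism (C D : coalgebra) (f : {linear C -> D}) :=
  (forall x, comul D (f x) = tmap f f (comul C x)) /\
  (forall x, counit D (f x) = counit C x).

Record cofree_coalgebra (V : lmodType K) := CofreeCoalgebra {
  cofree_coalg :> coalgebra;
  dereliction : {linear cofree_coalg -> V};
  cofree_lift : forall C : coalgebra, {linear C -> V} -> {linear C -> cofree_coalg};
  cofree_lift_morphism : forall (C : coalgebra) (f : {linear C -> V}),
    coalgebra_morphism (cofree_lift f);
  cofree_liftK : forall (C : coalgebra) (f : {linear C -> V}) x,
    dereliction (cofree_lift f x) = f x;
  cofree_lift_unique : forall (C : coalgebra) (f : {linear C -> V})
      (g : {linear C -> cofree_coalg}),
    coalgebra_morphism g -> (forall x, dereliction (g x) = f x) ->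
    g =1 cofree_lift f }.

End Coalgebra.

Arguments comul {K}.
Arguments counit {K}.
Arguments coalgebra_morphism {K C D}.

Section CoalgebraConstructions.
Context (K : fieldType).

Lemma pure0l (U V : lmodType K) (v : V) : pure (0 : U) v = 0.
Proof.
by have := pure_linearl v (-1) (0 : U) 0; rewrite scaler0 addr0 scaleN1r addNr.
Qed.

Lemma pure0r (U V : lmodType K) (u : U) : pure u (0 : V) = 0.
Proof.
by have := pure_linearr u (-1) (0 : V) 0; rewrite scaler0 addr0 scaleN1r addNr.
Qed.

Lemma pureDl (U V : lmodType K) (u u' : U) (v : V) :
  pure (u + u') v = pure u v + pure u' v.
Proof. by have := pure_linearl v 1 u u'; rewrite !scale1r. Qed.

Lemma pureDr (U V : lmodType K) (u : U) (v v' : V) :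
  pure u (v + v') = pure u v + pure u v'.
Proof. by have := pure_linearr u 1 v v'; rewrite !scale1r. Qed.

Lemma pureZl (U V : lmodType K) a (u : U) (v : V) :
  pure (a *: u) v = a *: pure u v.
Proof. by have := pure_linearl v a u 0; rewrite pure0l !addr0. Qed.

Lemma pureZr (U V : lmodType K) a (u : U) (v : V) :
  pure u (a *: v) = a *: pure u v.
Proof. by have := pure_linearr u a v 0; rewrite pure0r !addr0. Qed.

Fact coalg1_coassoc (x : K^o) :
  tassoc _ _ _ (tmap (tunitlV K^o) idfun (tunitlV K^o x))
  = tmap idfun (tunitlV K^o) (tunitlV K^o x).
Proof. by rewrite !tmapE /= tassocE. Qed.

Fact coalg1_counitl (x : K^o) : tunitl _ (tmap idfun idfun (tunitlV K^o x)) = x.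
Proof. by rewrite tmapE /= tunitlE scale1r. Qed.

Fact coalg1_cocomm (x : K^o) : tswap _ _ (tunitlV K^o x) = tunitlV K^o x.
Proof.
rewrite /= tswapE; have -> : x = x *: (1 : K^o) by rewrite [RHS]mulr1.
by rewrite pureZl pureZr.
Qed.

Definition coalg1 : coalgebra K := @Coalgebra K K^o (tunitlV K^o) idfun
  coalg1_coassoc coalg1_counitl coalg1_cocomm.

Section TensorCoalgebra.
Variables C D : coalgebra K.

Definition tcomul :
    {linear tensor C D -> tensor (tensor C D) (tensor C D)} :=
  tmid C C D D \o tmap (comul C) (comul D).

Definition tcounit : {linear tensor C D -> K^o} :=
  tunitl K^o \o tmap (counit C) (counit D).

Local Ltac tind x :=
  let h1 := fresh in let h2 := fresh in
  elim/tensor_ind: x => [|? ? ? h1 h2|? ?];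
  [ by rewrite ?linear0 ?(pure0l, pure0r) ?linear0 ?(pure0l, pure0r) ?linear0
      ?(pure0l, pure0r) ?linear0
  | by rewrite !(linearP, pure_linearl, pure_linearr) h1 h2 | ].

Fact tcoassoc x :
  tassoc _ _ _ (tmap tcomul idfun (tcomul x)) = tmap idfun tcomul (tcomul x).
Proof.
pose T : {linear tensor (tensor C (tensor C C)) (tensor D (tensor D D)) -> _} :=
  tmap idfun (tmid C C D D) \o tmid C (tensor C C) D (tensor D D).
have HT p q : T (pure p q) = tmap idfun (tmid C C D D) (tmid _ _ _ _ (pure p q)).
  by [].
have L p q : tassoc _ _ _ (tmap tcomul idfun (tmid C C D D (pure p q)))
    = T (pure (tassoc _ _ _ (tmap (comul C) idfun p))
              (tassoc _ _ _ (tmap (comul D) idfun q))).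
  tind p; tind q.
  rewrite tmidE !tmapE /= tmapE.
  move: (comul C _) (comul D _) => p q; tind p; tind q.
  by rewrite !(tmidE, tassocE, tmapE).
have R p q : tmap idfun tcomul (tmid C C D D (pure p q))
    = T (pure (tmap idfun (comul C) p) (tmap idfun (comul D) q)).
  tind p; tind q.
  by rewrite HT !(tmidE, tmapE) /= tmapE.
tind x.
by rewrite /= !tmapE L R !coassoc.
Qed.

Fact tcounitl x : tunitl _ (tmap tcounit idfun (tcomul x)) = x.
Proof.
have E p q : tunitl _ (tmap tcounit idfun (tmid C C D D (pure p q)))
    = pure (tunitl _ (tmap (counit C) idfun p))
           (tunitl _ (tmap (counit D) idfun q)).
  tind p; tind q.
  rewrite !(tmidE, tmapE) /= tmapE !tunitlE.
  by rewrite pureZl pureZr scalerA.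
tind x.
by rewrite /= tmapE E !counitl.
Qed.

Fact tcocomm x : tswap _ _ (tcomul x) = tcomul x.
Proof.
have E p q : tswap _ _ (tmid C C D D (pure p q))
    = tmid C C D D (pure (tswap _ _ p) (tswap _ _ q)).
  by tind p; tind q; rewrite !(tmidE, tswapE).
tind x.
by rewrite /= tmapE E !cocomm.
Qed.

Definition tensor_coalgebra : coalgebra K :=
  @Coalgebra K (tensor C D) tcomul tcounit tcoassoc tcounitl tcocomm.

End TensorCoalgebra.

(* the coalgebra k (+) V whose elements (0, v) are primitive over the grouplike
   (1, 0), i.e. the part of degree at most one of the symmetric coalgebra Sym V *)
Section PrimitiveCoalgebra.
Variable V : lmodType K.
Local Notation P := (K^o * V)%type.

Definition prim_one : P := (1, 0).
Definition prim_in (v : V) : P := (0, v).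

Definition prim_comul_fun (x : P) : tensor P P :=
  (x.1 : K) *: pure prim_one prim_one
  + pure prim_one (prim_in x.2) + pure (prim_in x.2) prim_one.

Fact prim_in_linear : linear prim_in.
Proof. by move=> a u v; congr pair; rewrite /= scaler0 addr0. Qed.

Fact prim_comul_linear : linear prim_comul_fun.
Proof.
move=> a x y; rewrite /prim_comul_fun /= prim_in_linear.
rewrite pure_linearl pure_linearr !scalerDr scalerA scalerDl.
set p := pure prim_one prim_one.
by rewrite [RHS]addrACA [X in _ = X + _]addrACA.
Qed.

Definition prim_comul : {linear P -> tensor P P} :=
  HB.pack_for {linear P -> tensor P P} prim_comul_fun
    (GRing.isLinear.Build K P (tensor P P) _ _ prim_comul_linear).

Definition prim_counit : {linear P -> K^o} := fst.

Fact prim_decomp (x : P) : x = (x.1 : K) *: prim_one + prim_in x.2.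
Proof.
case: x => a v; congr pair; rewrite /= ?scaler0 ?add0r ?addr0//.
by rewrite [RHS]mulr1.
Qed.

Fact prim_comul_one : prim_comul prim_one = pure prim_one prim_one.
Proof.
have E : prim_in 0 = 0 by [].
by rewrite /= /prim_comul_fun /= E pure0l pure0r scale1r !addr0.
Qed.

Fact prim_comul_in v :
  prim_comul (prim_in v) = pure prim_one (prim_in v) + pure (prim_in v) prim_one.
Proof. by rewrite /= /prim_comul_fun /= scale0r add0r. Qed.

Fact prim_coassoc x : tassoc _ _ _ (tmap prim_comul idfun (prim_comul x))
  = tmap idfun prim_comul (prim_comul x).
Proof.
rewrite (prim_decomp x) !linearP prim_comul_one prim_comul_in.
rewrite !linearD !tmapE !prim_comul_one !prim_comul_in.
rewrite !(pureDl, pureDr) !linearD !tassocE.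
by rewrite -!addrA.
Qed.

Fact prim_counitl x : tunitl _ (tmap prim_counit idfun (prim_comul x)) = x.
Proof.
rewrite [in LHS](prim_decomp x) !linearP prim_comul_one prim_comul_in.
rewrite !linearD !tmapE !tunitlE /=.
by rewrite !scale1r scale0r addr0 -prim_decomp.
Qed.

Fact prim_cocomm x : tswap _ _ (prim_comul x) = prim_comul x.
Proof.
rewrite (prim_decomp x) !linearP prim_comul_one prim_comul_in.
by rewrite !linearD !tswapE [pure _ prim_one + _]addrC.
Qed.

Definition prim_coalgebra : coalgebra K :=
  @Coalgebra K P prim_comul prim_counit prim_coassoc prim_counitl prim_cocomm.

End PrimitiveCoalgebra.
End CoalgebraConstructions.

Section Kets.
Context (K : fieldType) (V : lmodType K) (B : cofree_coalgebra V).

Fact ket_base_linear (P : V) :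
  linear (fun x : prim_coalgebra V => (x.1 : K) *: P + x.2).
Proof. by move=> a x y /=; rewrite scalerDl scalerDr !scalerA addrACA. Qed.

Definition ket_base (P : V) : {linear prim_coalgebra V -> V} :=
  HB.pack_for {linear prim_coalgebra V -> V}
    (fun x : prim_coalgebra V => (x.1 : K) *: P + x.2)
    (GRing.isLinear.Build K (prim_coalgebra V) V _ _ (ket_base_linear P)).

(* |{}>_P and |v>_P: the summand Sym_P(V) = Sym(V) of !V is embedded by the
   coalgebra morphism lifting 1 |-> P, v |-> v, Sym^n(V) |-> 0 for n > 1;
   these kets are the images of 1 and v *)
Definition vacuum (P : V) : B := cofree_lift B (ket_base P) (prim_one V).
Definition ket (P v : V) : B := cofree_lift B (ket_base P) (prim_in v).

Lemma dereliction_vacuum P : dereliction B (vacuum P) = P.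
Proof. by rewrite cofree_liftK /= scale1r addr0. Qed.

Lemma dereliction_ket P v : dereliction B (ket P v) = v.
Proof. by rewrite cofree_liftK /= scale0r add0r. Qed.

Lemma counit_vacuum P : counit B (vacuum P) = 1.
Proof. by rewrite (cofree_lift_morphism B (ket_base P)).2. Qed.

Lemma counit_ket P v : counit B (ket P v) = 0.
Proof. by rewrite (cofree_lift_morphism B (ket_base P)).2. Qed.

Lemma comul_vacuum P : comul B (vacuum P) = pure (vacuum P) (vacuum P).
Proof.
by rewrite (cofree_lift_morphism B (ket_base P)).1 [comul _ _]prim_comul_one tmapE.
Qed.

Lemma comul_ket P v :
  comul B (ket P v) = pure (vacuum P) (ket P v) + pure (ket P v) (vacuum P).
Proof.
rewrite (cofree_lift_morphism B (ket_base P)).1 [comul _ _]prim_comul_in.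
by rewrite linearD !tmapE.
Qed.

Lemma ket_linear P : linear (ket P).
Proof. by move=> a u v; rewrite /ket prim_in_linear linearP. Qed.
End Kets.

Inductive formula :=
| Atom of nat
| One
| Tens of formula & formula
| Lolly of formula & formula
| With of formula & formula
| Bang of formula.

(* [left_rule Gamma Delta]: a unary rule acting on the antecedent, from
   Gamma |- B to Delta |- B; [LSkip] lets it act behind a prefix, so that e.g.
   dereliction takes Gamma, A, Delta |- B to Gamma, !A, Delta |- B *)
Inductive left_rule : seq formula -> seq formula -> Type :=
| LExch A B G : left_rule (A :: B :: G) (B :: A :: G)
| LOne G : left_rule G (One :: G)
| LTens A B G : left_rule (A :: B :: G) (Tens A B :: G)
| LWith1 A B G : left_rule (A :: G) (With A B :: G)
| LWith2 A B G : left_rule (B :: G) (With A B :: G)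
| LDer A G : left_rule (A :: G) (Bang A :: G)
| LCtr A G : left_rule (Bang A :: Bang A :: G) (Bang A :: G)
| LWk A G : left_rule G (Bang A :: G)
| LSkip A G D : left_rule G D -> left_rule (A :: G) (A :: D).

Inductive proof : seq formula -> formula -> Type :=
| Ax A : proof [:: A] A
| Cut G D A B : proof G A -> proof (A :: D) B -> proof (G ++ D) B
| Left G D B : left_rule G D -> proof G B -> proof D B
| ROne : proof [::] One
| RTens G D A B : proof G A -> proof D B -> proof (G ++ D) (Tens A B)
| RLolly G A B : proof (A :: G) B -> proof G (Lolly A B)
| LLolly G D A B C :
    proof G A -> proof (B :: D) C -> proof (G ++ Lolly A B :: D) C
| RWith G A B : proof G A -> proof G B -> proof G (With A B)
| Prom G A : proof (map Bang G) A -> proof (map Bang G) (Bang A).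

Section Semantics.
Context (K : fieldType).
Variable cofree : forall V : lmodType K, cofree_coalgebra V.
Variable atom : nat -> lmodType K.

Fixpoint sem (A : formula) : lmodType K :=
  match A with
  | Atom n => atom n
  | One => K^o
  | Tens A B => tensor (sem A) (sem B)
  | Lolly A B => hom (sem A) (sem B)
  | With A B => (sem A * sem B)%type
  | Bang A => cofree (sem A)
  end.

(* [[A_1, ..., A_n]] = [[A_1]] (x) (... (x) ([[A_n]] (x) k)) *)
Fixpoint sem_ctx (G : seq formula) : lmodType K :=
  if G is A :: G' then tensor (sem A) (sem_ctx G') else K^o.

Fixpoint sem_left G D (r : left_rule G D) : {linear sem_ctx D -> sem_ctx G} :=
  match r with
  | LExch A B G => tassoc _ _ _ \o tmap (tswap _ _) idfun \o tassocV _ _ _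
  | LOne G => tunitl _
  | LTens A B G => tassoc _ _ _
  | LWith1 A B G => tmap fst idfun
  | LWith2 A B G => tmap snd idfun
  | LDer A G => tmap (dereliction (cofree (sem A))) idfun
  | LCtr A G => tassoc _ _ _ \o tmap (comul (cofree (sem A))) idfun
  | LWk A G => tunitl _ \o tmap (counit (cofree (sem A))) idfun
  | LSkip A G D r => tmap idfun (sem_left r)
  end.

Fixpoint sem_split (G D : seq formula) :
    {linear sem_ctx (G ++ D) -> tensor (sem_ctx G) (sem_ctx D)} :=
  match G with
  | [::] => tunitlV _
  | A :: G' => tassocV _ _ _ \o tmap idfun (sem_split G' D)
  end.

Fixpoint bang_coalgebra (G : seq formula) : coalgebra K :=
  if G is A :: G' then tensor_coalgebra (cofree (sem A)) (bang_coalgebra G')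
  else coalg1 K.

Fixpoint to_bang_coalgebra (G : seq formula) :
    {linear sem_ctx (map Bang G) -> bang_coalgebra G} :=
  match G with
  | [::] => idfun
  | A :: G' => tmap idfun (to_bang_coalgebra G')
  end.

Fixpoint of_bang_coalgebra (G : seq formula) :
    {linear bang_coalgebra G -> sem_ctx (map Bang G)} :=
  match G with
  | [::] => idfun
  | A :: G' => tmap idfun (of_bang_coalgebra G')
  end.

Fixpoint sem_proof G B (p : proof G B) : {linear sem_ctx G -> sem B} :=
  match p with
  | Ax A => tunitr _
  | Cut G D A B p q => sem_proof q \o tmap (sem_proof p) idfun \o sem_split G D
  | Left G D B r p => sem_proof p \o sem_left r
  | ROne => idfun
  | RTens G D A B p q => tmap (sem_proof p) (sem_proof q) \o sem_split G D
  | RLolly G A B p => tcurry (sem_proof p)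
  | LLolly G D A B C p q =>
      sem_proof q \o tmap (teval _ _) idfun \o tassocV _ _ _
      \o tmap (sem_proof p) idfun \o sem_split G (Lolly A B :: D)
  | RWith G A B p q => lpair (sem_proof p) (sem_proof q)
  | Prom G A p =>
      cofree_lift (cofree (sem A)) (sem_proof p \o of_bang_coalgebra G)
      \o to_bang_coalgebra G
  end.

Definition sem_closed B (p : proof [::] B) : sem B := sem_proof p (1 : K^o).

End Semantics.

Inductive left_rules : seq formula -> seq formula -> Type :=
| LNil G : left_rules G G
| LCons G D E : left_rule G D -> left_rules D E -> left_rules G E.

Fixpoint lefts G D (c : left_rules G D) B : proof G B -> proof D B :=
  match c with
  | LNil G => fun p => p
  | LCons G D E l c => fun p => lefts c (Left l p)
  end.

Fixpoint left_rules_skip A G D (c : left_rules G D) :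
    left_rules (A :: G) (A :: D) :=
  match c with
  | LNil G => LNil (A :: G)
  | LCons G D E l c => LCons (LSkip A l) (left_rules_skip A c)
  end.

Section Plain.
Context (r : nat) (A : 'I_r -> formula) (n : 'I_r -> nat).

(* [copies] enumerates the occurrences in n_1 A_1, ..., n_r A_r *)
Definition copies : seq {i : 'I_r & 'I_(n i)} :=
  [seq Tagged (fun i => 'I_(n i)) j | i <- enum 'I_r, j <- enum 'I_(n i)].

Definition copies_ctx (s : seq {i : 'I_r & 'I_(n i)}) : seq formula :=
  [seq A (tag k) | k <- s].

Definition bang_ctx (t : seq 'I_r) : seq formula := [seq Bang (A i) | i <- t].

Fixpoint der_all (s : seq {i : 'I_r & 'I_(n i)}) :
    left_rules (copies_ctx s) (bang_ctx (map tag s)) :=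
  match s with
  | [::] => LNil _
  | k :: s' => LCons (LDer (A (tag k)) (copies_ctx s'))
                     (left_rules_skip (Bang (A (tag k))) (der_all s'))
  end.

(* a contraction or weakening that keeps track of the index i of each !A_i, so
   that copies of !A_i and !A_j are not merged when A_i = A_j and i <> j *)
Inductive ctr_wk : seq 'I_r -> seq 'I_r -> Type :=
| CtrStep i t : ctr_wk (i :: i :: t) (i :: t)
| WkStep i t : ctr_wk t (i :: t)
| SkipStep i t t' : ctr_wk t t' -> ctr_wk (i :: t) (i :: t').

Fixpoint ctr_wk_rule t t' (c : ctr_wk t t') :
    left_rule (bang_ctx t) (bang_ctx t') :=
  match c with
  | CtrStep i t => LCtr (A i) (bang_ctx t)
  | WkStep i t => LWk (A i) (bang_ctx t)
  | SkipStep i t t' c => LSkip (Bang (A i)) (ctr_wk_rule c)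
  end.

Inductive plain_from B (pi : proof (copies_ctx copies) B) :
    forall t, proof (bang_ctx t) B -> Prop :=
| PlainDer : plain_from pi (t := map tag copies) (lefts (der_all copies) pi)
| PlainCtrWk t t' (c : ctr_wk t t') (phi : proof (bang_ctx t) B) :
    plain_from pi phi -> plain_from pi (Left (ctr_wk_rule c) phi).

(* pi(X_1, ..., X_r): all hypotheses of pi are cut against closed proofs *)
Fixpoint cut_all (X : forall k : {i : 'I_r & 'I_(n i)}, proof [::] (A (tag k)))
    s B : proof (copies_ctx s) B -> proof [::] B :=
  match s with
  | [::] => fun p => p
  | k :: s' => fun p => cut_all X (s := s') (Cut (X k) p)
  end.

End Plain.
Arguments copies {r}.
Arguments bang_ctx {r}.
Arguments copies_ctx {r} A {n}.

Section PureTensor.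
Context (K : fieldType).
Variable cofree : forall V : lmodType K, cofree_coalgebra V.
Variable atom : nat -> lmodType K.

Fixpoint pure_ctx (I : Type) (f : I -> formula)
    (x : forall i, sem cofree atom (f i)) (s : seq I) :
    sem_ctx cofree atom (map f s) :=
  match s with
  | [::] => (1 : K^o)
  | i :: s' => pure (x i) (pure_ctx x s')
  end.

End PureTensor.

Section Probability.
Context (R : realType).
Variable cofree : forall V : lmodType R[i], cofree_coalgebra V.
Variable atom : nat -> lmodType R[i].
Local Notation "[[ A ]]" := (sem cofree atom A).

Definition simplex (m : nat) : set 'rV[R]_m :=
  [set x | (forall j, 0 <= x 0 j) /\ \sum_j x 0 j = 1].

(* a finite set of proofs is given as a family indexed by 'I_m; then R P is
   'rV[R]_m and [sem_comb P] is the map R P -> [[A]] *)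
Definition sem_comb (A : formula) (m : nat) (P : 'I_m -> proof [::] A)
    (x : 'rV[R]_m) : [[A]] :=
  \sum_j (x 0 j)%:C%C *: sem_closed cofree atom (P j).

Context (r : nat) (p : 'I_r -> nat).

(* R P_1 x ... x R P_r is 'rV[R]_(\sum_i p i), with i-th component
   [submxrow v i]; the coordinate x^i_rho has index [tagnat.Rank i rho] *)
Definition prod_simplex : set 'rV[R]_(\sum_i p i) :=
  [set v | forall i, simplex (submxrow v i)].

Definition tangent_basis (i : 'I_r) (zeta rho : 'I_(p i)) :
    'rV[R]_(\sum_i p i) :=
  delta_mx 0 (tagnat.Rank i zeta) - delta_mx 0 (tagnat.Rank i rho).

Context (A : 'I_r -> formula) (B : formula).
Variables (P : forall i, 'I_(p i) -> proof [::] (A i)).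
Variables (q : nat) (Q : 'I_q -> proof [::] B).
Variable psi : proof (bang_ctx A (enum 'I_r)) B.

Definition vacua (v : 'rV[R]_(\sum_i p i)) (i : 'I_r) : [[Bang (A i)]] :=
  vacuum (cofree [[A i]]) (sem_comb (@P i) (submxrow v i)).

(* the value at v is the unique u with the stated property; meaningful for v in
   [prod_simplex] only *)
Definition naive_extension (v : 'rV[R]_(\sum_i p i)) : 'rV[R]_q :=
  xget 0 [set u | simplex u /\
    sem_proof cofree atom psi (pure_ctx (vacua v) (enum 'I_r)) = sem_comb Q u].

End Probability.

(* The tangent map at w of g : S -> W, for S a manifold with corners in V: the
   differential of an extension of g to V that is differentiable at w. On
   the span of S - w, for S convex, it does not depend on the extension *)
Definition tangent_map (R : realType) (V W : normedModType R) (S : set V)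
    (g : V -> W) (w : V) : V -> W :=
  'd (xget g [set F : V -> W | {in S, F =1 g} /\ differentiable F w]) w.
Arguments simplex : clear implicits.
Arguments prod_simplex R {r} p.
Arguments tangent_basis R {r p i}.

(* Main.v *)
From HB Require Import structures.
Require Import Defs.
From mathcomp Require Import all_boot all_order all_algebra.
From mathcomp Require Import all_classical all_reals all_analysis.
From mathcomp Require Import complex.

(* A vacuum |0>_P is grouplike and a ket |v>_P is primitive over it, so as v
   varies the kets satisfy the Leibniz rule under comultiplication: replacing
   each vacuum in turn by a ket and summing commutes with contraction and
   weakening, and dereliction turns vacua and kets into the points P and the
   directions v. Hence the semantics of psi on the sum of these insertions is
   the formal derivative of the multilinear map given by pi at the points w_i,
   in the directions v_i. Since pi maps the proofs in P_i into Q, this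
   multilinear map is a polynomial map into R Q, of which the formal derivative
   is the differential; it extends the naive extension. Any other differentiable
   extension has the same differential along the simplices. *)

Set Implicit Arguments.
Unset Strict Implicit.
Unset Printing Implicit Defensive.

Import Order.TTheory GRing.Theory Num.Theory numFieldNormedType.Exports.
Local Open Scope classical_set_scope.
Local Open Scope ring_scope.

(** * Semantics of plain proofs on pure tensors and on their formal derivatives *)

Section ProofSemantics.
Context (K : fieldType).
Variable cofree : forall V : lmodType K, cofree_coalgebra V.
Variable atom : nat -> lmodType K.
Local Notation "[[ A ]]" := (sem cofree atom A).

Fixpoint sem_lefts G D (c : left_rules G D) :
    {linear sem_ctx cofree atom D -> sem_ctx cofree atom G} :=
  match c with
  | LNil _ => idfun
  | LCons _ _ _ l c => sem_left cofree atom l \o sem_lefts c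
  end.

Lemma sem_proof_lefts G D (c : left_rules G D) B (pi : proof G B) x :
  sem_proof cofree atom (lefts c pi) x
  = sem_proof cofree atom pi (sem_lefts c x).
Proof. by elim: c pi x => //= {}G D' E l c IHc pi x; rewrite IHc. Qed.

Lemma sem_lefts_skip A G D (c : left_rules G D) (x : [[A]])
    (y : sem_ctx cofree atom D) :
  sem_lefts (left_rules_skip A c) (pure x y) = pure x (sem_lefts c y).
Proof. by elim: c y => //= {}G D' E l c IHc y; rewrite IHc tmapE. Qed.

Lemma sem_proof_cut A D B (pi : proof [::] A) (phi : proof (A :: D) B) y :
  sem_proof cofree atom (Cut pi phi) y
  = sem_proof cofree atom phi (pure (sem_closed cofree atom pi) y).
Proof. by rewrite /= tmapE. Qed.

(** The Leibniz sum of all insertions of one [y i] into the tensor of the [x i]. Recursion on [s]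
    makes an index that is repeated in [s] contribute once for each occurrence, as contraction
    requires. *)
Fixpoint pure_ctx_deriv (I : Type) (f : I -> formula)
    (x y : forall i, [[f i]]) (s : seq I) : sem_ctx cofree atom (map f s) :=
  if s is i :: s' then
    pure (y i) (pure_ctx x s') + pure (x i) (pure_ctx_deriv x y s')
  else 0.

Lemma pure_ctx_eq (I : eqType) (f : I -> formula) (x x' : forall i, [[f i]])
    (s : seq I) :
  {in s, forall i, x i = x' i} ->
  pure_ctx x s = pure_ctx x' s.
Proof.
elim: s => //= i s IHs xx'; congr (pure _ _); first by rewrite xx' ?mem_head.
by apply: IHs => j js; rewrite xx' // inE js orbT.
Qed.

(** Every insertion away from [i] has a zero factor, and [i] occurs just once in [s]. So a single
    ket among vacua is a full Leibniz sum, for directions concentrated at [i]. *)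
Lemma pure_ctx_deriv_dfwith (I : eqType) (f : I -> formula)
    (x y : forall i, [[f i]]) (s : seq I) (i : I) :
  uniq s -> i \in s -> (forall j, j != i -> y j = 0) ->
  pure_ctx_deriv x y s = pure_ctx (dfwith x i (y i)) s.
Proof.
move=> us is_ y0.
have notin_deriv t : i \notin t -> pure_ctx_deriv x y t = 0.
  elim: t => //= j t IHt; rewrite inE negb_or eq_sym => /andP[/y0-> /IHt->].
  by rewrite pure0l pure0r addr0.
elim: s us is_ => //= j s IHs /andP[js us]; rewrite inE.
have [ij|ij] /= := eqVneq i j.
  subst j; rewrite dfwithin notin_deriv // pure0r addr0 => _.
  congr (pure _ _); apply: pure_ctx_eq => k ks; rewrite dfwithout //.
  by apply: contraNneq js => ->.
by move=> is_; rewrite IHs // dfwithout // y0 1?eq_sym // pure0l add0r.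
Qed.

Section Plain.
Context (r : nat) (A : 'I_r -> formula) (n : 'I_r -> nat).
Local Notation copy := {i : 'I_r & 'I_(n i)}.

Lemma sem_closed_cut_all (X : forall k : copy, proof [::] (A (tag k))) s B
    (pi : proof (copies_ctx A s) B) :
  sem_closed cofree atom (cut_all X pi)
  = sem_proof cofree atom pi
      (pure_ctx (fun k => sem_closed cofree atom (X k)) s).
Proof. by elim: s pi => //= k s IHs pi; rewrite IHs sem_proof_cut. Qed.

Local Notation der j := (dereliction (cofree [[A j]])).

Lemma sem_der_all (g : forall j, [[Bang (A j)]]) (s : seq copy) :
  sem_lefts (der_all A s)
    (pure_ctx (f := fun j => Bang (A j)) g (map tag s))
  = pure_ctx (f := fun k : copy => A (tag k))
      (fun k => der (tag k) (g (tag k))) s.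
Proof. by elim: s => //= k s IHs; rewrite sem_lefts_skip IHs tmapE. Qed.

Lemma sem_der_all_deriv (g d : forall j, [[Bang (A j)]]) (s : seq copy) :
  sem_lefts (der_all A s)
    (pure_ctx_deriv (f := fun j => Bang (A j)) g d (map tag s))
  = pure_ctx_deriv (f := fun k : copy => A (tag k))
      (fun k => der (tag k) (g (tag k))) (fun k => der (tag k) (d (tag k))) s.
Proof.
elim: s => [//|k s IHs] /=.
rewrite (linearD (sem_lefts (left_rules_skip _ _))) !sem_lefts_skip IHs.
by rewrite sem_der_all linearD !tmapE.
Qed.

Section CtrWk.
Context (g d : forall j, [[Bang (A j)]]).
Context (g_comul : forall j,
  comul (cofree [[A j]]) (g j) = pure (g j) (g j)).
Context (g_counit : forall j, counit (cofree [[A j]]) (g j) = 1).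
Context (d_comul : forall j,
  comul (cofree [[A j]]) (d j) = pure (g j) (d j) + pure (d j) (g j)).
Context (d_counit : forall j, counit (cofree [[A j]]) (d j) = 0).

Local Notation vac t := (pure_ctx (f := fun j => Bang (A j)) g t).
Local Notation tan t := (pure_ctx_deriv (f := fun j => Bang (A j)) g d t).

Lemma sem_ctr_wk t t' (c : ctr_wk t t') :
  sem_left cofree atom (ctr_wk_rule A c) (vac t') = vac t.
Proof.
elim: c => [i {}t|i {}t|i {}t {}t' c IHc] /=.
- by rewrite tmapE g_comul tassocE.
- by rewrite tmapE g_counit tunitlE scale1r.
- by rewrite tmapE IHc.
Qed.

(** Contraction: comultiplying the primitive [d i] gives the insertions at the two copies, while
    [g i] is duplicated in all others. Weakening: the counit kills [d i], so the insertion at the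
    weakened hypothesis disappears. *)
Lemma sem_ctr_wk_deriv t t' (c : ctr_wk t t') :
  sem_left cofree atom (ctr_wk_rule A c) (tan t') = tan t.
Proof.
elim: c => [i {}t|i {}t|i {}t {}t' c IHc] /=.
- rewrite !linearD !tmapE d_comul g_comul pureDl linearD !tassocE pureDr.
  by rewrite addrCA addrA.
- by rewrite !linearD !tmapE d_counit g_counit !tunitlE scale0r add0r scale1r.
- by rewrite linearD !tmapE IHc sem_ctr_wk.
Qed.

Lemma sem_plain B (pi : proof (copies_ctx A (copies n)) B) t
    (phi : proof (bang_ctx A t) B) : plain_from pi phi ->
  sem_proof cofree atom phi (vac t)
  = sem_proof cofree atom pi (pure_ctx (f := fun k : copy => A (tag k))
      (fun k => der (tag k) (g (tag k))) (copies n)).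
Proof.
elim=> {t phi} [|t t' c phi _ IH]; first by rewrite sem_proof_lefts sem_der_all.
by rewrite /= sem_ctr_wk.
Qed.

Lemma sem_plain_deriv B (pi : proof (copies_ctx A (copies n)) B) t
    (phi : proof (bang_ctx A t) B) : plain_from pi phi ->
  sem_proof cofree atom phi (tan t)
  = sem_proof cofree atom pi (pure_ctx_deriv (f := fun k : copy => A (tag k))
      (fun k => der (tag k) (g (tag k)))
      (fun k => der (tag k) (d (tag k))) (copies n)).
Proof.
elim=> {t phi} [|t t' c phi _ IH]; last by rewrite /= sem_ctr_wk_deriv.
by rewrite sem_proof_lefts sem_der_all_deriv.
Qed.

End CtrWk.
End Plain.
End ProofSemantics.

(** * Differential calculus: product rule, one-sided derivatives, coordinates *)

Section Differential.
Context (R : realType) (V W : normedModType R).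

Fact scale_bilinear : bilinear_for
  (GRing.Scale.Law.clone _ _ *:%R _) (GRing.Scale.Law.clone _ _ *:%R _)
  ( *:%R : R -> W -> W).
Proof.
split=> [v|a] b x y /=; first by rewrite scalerDl scalerA.
by rewrite scalerDr !scalerA mulrC.
Qed.

HB.instance Definition _ :=
  bilinear_isBilinear.Build R R W W _ _ ( *:%R : R -> W -> W) scale_bilinear.

Lemma is_diff_scale (k dk : V -> R) (f df : V -> W) x :
  is_diff x k dk -> is_diff x f df ->
  is_diff x (fun y => k y *: f y) (fun y => k x *: df y + dk y *: f x).
Proof.
move=> dkx dfx.
have sc : continuous (fun p : R * W => p.1 *: p.2) by exact: scale_continuous.
have sd (p : R * W) : is_diff p (fun q : R * W => q.1 *: q.2)
    (fun q => p.1 *: q.2 + q.1 *: p.2).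
  apply: DiffDef; last by rewrite (diff_bilin (f := ( *:%R : R -> W -> W))).
  exact: (differentiable_bilin (f := ( *:%R : R -> W -> W))).
(* The product is the bilinear scaling composed with the pairing of [k] and [f], so the chain rule
   applies. *)
rewrite -[X in is_diff _ X _]/((fun q : R * W => q.1 *: q.2) \o
                               (fun y => (k y, f y))).
exact: is_diff_comp.
Qed.

Lemma is_diff_sum (I : Type) (s : seq I) (f df : I -> V -> W) x :
  (forall i, is_diff x (f i) (df i)) ->
  is_diff x (fun y => \sum_(i <- s) f i y) (fun y => \sum_(i <- s) df i y).
Proof.
move=> dfx; elim: s => [|i s IHs].
  under eq_fun do rewrite big_nil.
  under [X in is_diff _ _ X]eq_fun do rewrite big_nil.
  exact: is_diff_cst.
under eq_fun do rewrite big_cons.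
under [X in is_diff _ _ X]eq_fun do rewrite big_cons.
exact: is_diffD.
Qed.

(** A directional derivative is already determined by its limit from the right, where the difference
    quotient vanishes. From a corner of a simplex only such half-rays are available. *)
Lemma diff_eq0_ray (G : V -> W) (w u : V) :
  differentiable G w -> (\forall t \near (0 : R)^'+, G (t *: u + w) = G w) ->
  'd G w u = 0.
Proof.
move=> dG G0; rewrite -deriveE //.
have dv : (fun h => h^-1 *: (G (h *: u + w) - G w)) @ (0 : R)^'+ --> 'D_u G w.
  apply: cvg_trans (diff_derivable dG (v := u)) => E.
  by apply: (@filterS _ (nbhs (0:R))) => z Ez z0; apply: Ez; rewrite gt_eqF.
apply: (cvg_unique _ dv) => //; apply: cvg_near_cst.
by apply: filterS G0 => t ->; rewrite subrr scaler0.
Qed.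

Lemma is_diff_coord m n (M : 'M[R]_(m, n)) i j :
  is_diff M (fun N : 'M[R]_(m, n) => N i j) (fun N => N i j).
Proof.
have lin : linear (fun N : 'M[R]_(m, n) => N i j) by move=> a x y; rewrite !mxE.
pose f : {linear 'M[R]_(m, n) -> R} :=
  HB.pack (fun N : 'M[R]_(m, n) => N i j) (GRing.isLinear.Build _ _ _ _ _ lin).
apply: DiffDef; first exact: differentiable_coord.
by rewrite (diff_lin (f := f)) //; exact: coord_continuous.
Qed.
End Differential.

(** * The real-linear map from formal combinations of proofs to denotations *)

Section SemComb.
Context (R : realType).
Variable cofree : forall V : lmodType R[i], cofree_coalgebra V.
Variable atom : nat -> lmodType R[i].
Context (B : formula) (q : nat) (Q : 'I_q -> proof [::] B).
Local Notation comb := (sem_comb cofree atom Q).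

(** Linearity is spelled out with the embedding of [R] in [R[i]], because source and target are
    modules over different fields. *)
Lemma sem_combP (a : R) (u v : 'rV_q) :
  comb (a *: u + v) = (a%:C)%C *: comb u + comb v.
Proof.
rewrite /sem_comb scaler_sumr -big_split /=; apply: eq_bigr => j _.
by rewrite !mxE rmorphD rmorphM /= scalerDl scalerA.
Qed.

Lemma sem_comb0 : comb 0 = 0.
Proof. by rewrite /sem_comb big1 // => j _; rewrite mxE scale0r. Qed.

Lemma sem_combD (u v : 'rV_q) : comb (u + v) = comb u + comb v.
Proof. by have := sem_combP 1 u v; rewrite !scale1r. Qed.

Lemma sem_combB (u v : 'rV_q) : comb (u - v) = comb u - comb v.
Proof.
have := sem_combP (-1) v u; rewrite rmorphN1 !scaleN1r addrC => ->.
by rewrite addrC.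
Qed.

Lemma sem_comb_sum (I : Type) (s : seq I) (a : I -> R) (u : I -> 'rV_q) :
  comb (\sum_(i <- s) a i *: u i) = \sum_(i <- s) ((a i)%:C)%C *: comb (u i).
Proof.
elim: s => [|i s IHs]; first by rewrite !big_nil sem_comb0.
by rewrite !big_cons sem_combP IHs.
Qed.

Lemma sem_comb_delta j : comb (delta_mx 0 j) = sem_closed cofree atom (Q j).
Proof.
rewrite /sem_comb (bigD1 j) //= mxE !eqxx scale1r big1 ?addr0 // => k kj.
by rewrite mxE (negbTE kj) scale0r.
Qed.

(** Two rows with the same image differ by a linear relation with real coefficients. Injectivity is
    what pins down the value of the naive extension. *)
Lemma sem_comb_inj :
  (forall c : 'I_q -> R[i],
     \sum_t c t *: sem_closed cofree atom (Q t) = 0 -> forall t, c t = 0) ->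
  injective comb.
Proof.
move=> Qfree u v /eqP; rewrite -subr_eq0 -sem_combB => /eqP /Qfree uv0.
apply/rowP => j; have := uv0 j; rewrite !mxE => -[/eqP].
by rewrite subr_eq0 => /eqP.
Qed.

End SemComb.

(** * Convexity of simplices, and tangent vectors of their products *)

Lemma simplex_delta (R : realType) m (j : 'I_m) : simplex R m (delta_mx 0 j).
Proof.
split=> [k|]; first by rewrite mxE; exact: ler0n.
rewrite (bigD1 j) //= mxE !eqxx big1 ?addr0 // => k kj.
by rewrite mxE (negbTE kj).
Qed.

Lemma simplex_conv (R : realType) m (I : finType) (a : I -> R)
    (u : I -> 'rV_m) :
  (forall i, 0 <= a i) -> \sum_i a i = 1 -> (forall i, simplex R m (u i)) ->
  simplex R m (\sum_i a i *: u i).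
Proof.
move=> a0 a1 ui; split=> [j|].
  rewrite summxE; apply: sumr_ge0 => i _; rewrite mxE mulr_ge0 //.
  by have [] := ui i.
under eq_bigr do rewrite summxE.
rewrite exchange_big /= -[RHS]a1; apply: eq_bigr => i _.
under eq_bigr do rewrite mxE.
by rewrite -mulr_sumr (ui i).2 mulr1.
Qed.

Section ProdSimplex.
Context (R : realType) (r : nat) (p : 'I_r -> nat).

Lemma prod_simplex_conv (t : R) (v w : 'rV_(\sum_i p i)) : 0 <= t <= 1 ->
  prod_simplex R p v -> prod_simplex R p w ->
  prod_simplex R p (t *: (v - w) + w).
Proof.
move=> /andP[t0 t1] Sv Sw j.
have [[v0 v1] [w0 w1]] := (Sv j, Sw j).
have E k : submxrow (t *: (v - w) + w) j 0 k
    = t * submxrow v j 0 k + (1 - t) * submxrow w j 0 k.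
  by rewrite !mxE mulrBr mulrBl mul1r addrAC addrA.
split=> [k|]; first by rewrite E addr_ge0 // mulr_ge0 // subr_ge0.
rewrite (eq_bigr _ (fun k _ => E k)) big_split /= -!mulr_sumr v1 w1 !mulr1.
by rewrite addrC subrK.
Qed.

Lemma submxrow_tangent_basis (i : 'I_r) (zeta rho : 'I_(p i)) j :
  submxrow (tangent_basis R zeta rho) j
  = dfwith (fun j => 0 : 'rV[R]_(p j)) i (delta_mx 0 zeta - delta_mx 0 rho) j.
Proof.
(* Positions in the concatenated row correspond bijectively to pairs of a block and a position in
   it. *)
have E k l : tagnat.Rank (p_ := p) j k == tagnat.Rank i l
    = (Tagged (fun i => 'I_(p i)) k == Tagged (fun i => 'I_(p i)) l).
  by rewrite /tagnat.Rank (inj_eq (@tagnat.rank_inj _ _)).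
apply/rowP => k; rewrite !mxE !E /=.
case: dfwithP k {E} => [k|{}j ij k].
  by rewrite !mxE !eqxx /= -!tag_eqE /tag_eq /= !eqxx !tagged_asE.
by rewrite -!tag_eqE /tag_eq /= eq_sym (negbTE ij) mxE subrr.
Qed.

Definition replace_block (w : 'rV[R]_(\sum_i p i)) (i : 'I_r)
    (zeta : 'I_(p i)) : 'rV[R]_(\sum_i p i) :=
  \mxrow_j dfwith (fun j => submxrow w j) i (delta_mx 0 zeta) j.

Lemma prod_simplex_replace_block w i (zeta : 'I_(p i)) :
  prod_simplex R p w -> prod_simplex R p (replace_block w zeta).
Proof.
move=> Sw j; rewrite mxrowK.
by case: dfwithP => [|{}j _]; [exact: simplex_delta|exact: Sw].
Qed.

Lemma replace_blockB w i (zeta rho : 'I_(p i)) :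
  replace_block w zeta - replace_block w rho = tangent_basis R zeta rho.
Proof.
apply/mxrowP => j; rewrite submxrowB !mxrowK submxrow_tangent_basis.
have [<-|ij] := eqVneq i j; first by rewrite !dfwithin.
by rewrite !dfwithout // subrr.
Qed.

(* At a corner [w] the vector [tangent_basis zeta rho] need not point into the
   simplex, nor need its opposite; but it is the difference of two vectors
   which do, from [w] to the points with [zeta], resp. [rho], as i-th
   component. *)
Lemma diff_eq_on_prod_simplex (W : normedModType R)
    (f g : 'rV_(\sum_i p i) -> W) w i (zeta rho : 'I_(p i)) :
  prod_simplex R p w -> (forall v, prod_simplex R p v -> f v = g v) ->
  differentiable f w -> differentiable g w ->
  'd f w (tangent_basis R zeta rho) = 'd g w (tangent_basis R zeta rho).
Proof.
move=> Sw fg df dg; apply/eqP; rewrite -subr_eq0; apply/eqP.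
have dfg : differentiable (f - g) w by exact: differentiableB.
have d0 (k : 'I_(p i)) : 'd (f - g) w (replace_block w k - w) = 0.
  apply: diff_eq0_ray => //; near=> t.
  (* For small [t >= 0] the point lies on the segment from [w] to [replace_block w k], where [f] and
     [g] agree. *)
  have St : prod_simplex R p (t *: (replace_block w k - w) + w).
    apply: prod_simplex_conv => //; last exact: prod_simplex_replace_block.
    by apply/andP; split; near: t; [exact: nbhs_right_ge|exact: nbhs_right_le].
  by rewrite !fctE !fg // !subrr.
have -> : tangent_basis R zeta rho
    = (replace_block w zeta - w) - (replace_block w rho - w).
  by rewrite opprB addrA subrK replace_blockB.
have <- h : 'd (f - g) w h = 'd f w h - 'd g w h by rewrite diffB.
by rewrite linearB !d0 subrr.
Unshelve. all: by end_near. Qed.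

End ProdSimplex.

(** * The polynomial map induced by a multilinear map on proofs *)

Section PureLeft.
Context (K : fieldType) (U V : lmodType K) (u : U).

Definition pure_left : {linear V -> tensor U V} :=
  HB.pack_for {linear V -> tensor U V} (pure u)
    (GRing.isLinear.Build K V (tensor U V) _ (pure u) (pure_linearr u)).

End PureLeft.

Section Polynomial.
Context (R : realType).
Variable cofree : forall V : lmodType R[i], cofree_coalgebra V.
Variable atom : nat -> lmodType R[i].
Context (r : nat) (p : 'I_r -> nat) (A : 'I_r -> formula) (B : formula).
Variable P : forall i, 'I_(p i) -> proof [::] (A i).
Context (q : nat) (Q : 'I_q -> proof [::] B).

Local Notation comb j v := (sem_comb cofree atom (@P j) (submxrow v j)).

Lemma linear_pure_comb (V : lmodType R[i]) (W : lmodType R[i]) i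
    (L : {linear tensor (sem cofree atom (A i)) V -> W})
    (v : 'rV_(\sum_i p i)) y :
  L (pure (comb i v) y)
  = \sum_j ((v 0 (tagnat.Rank i j))%:C)%C
      *: L (pure (sem_closed cofree atom (@P i j)) y).
Proof.
rewrite /sem_comb (big_morph (pure^~ y) (fun a b => pureDl a b y) (pure0l _ y)).
by rewrite linear_sum; apply: eq_bigr => j _; rewrite pureZl linearZ !mxE.
Qed.

Context (n : 'I_r -> nat).
Local Notation copy := {i : 'I_r & 'I_(n i)}.

(** [f] represents [L] at points, and [df] is at once the differential of [f] and the representative
    of the formal derivative of [L]. The last clause is there because the naive extension takes its
    values in the simplex. *)
Definition is_lift (s : seq copy)
    (L : {linear sem_ctx cofree atom (copies_ctx A s) -> sem cofree atom B})
    (f : 'rV[R]_(\sum_i p i) -> 'rV[R]_q)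
    (df : 'rV[R]_(\sum_i p i) -> 'rV[R]_(\sum_i p i) -> 'rV[R]_q) : Prop :=
  [/\ forall w, is_diff w f (df w),
      forall v, L (pure_ctx (f := fun k : copy => A (tag k))
                     (fun k => comb (tag k) v) s)
        = sem_comb cofree atom Q (f v),
      forall w h, L (pure_ctx_deriv (f := fun k : copy => A (tag k))
                       (fun k => comb (tag k) w) (fun k => comb (tag k) h) s)
        = sem_comb cofree atom Q (df w h) &
      forall v, prod_simplex R p v -> simplex R q (f v)].

(* The polynomial map f_psi of the paper, built one variable at a time: the
   first tensor factor only matters through its coordinates x_j, and plugging in
   the j-th proof leaves a shorter L_j, so that f = \sum_j x_j f_j. *)
Lemma exists_lift (s : seq copy)
    (L : {linear sem_ctx cofree atom (copies_ctx A s) -> sem cofree atom B}) :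
  (forall i, 'I_(p i)) -> uniq s ->
  (forall gamma : (forall k : copy, 'I_(p (tag k))), exists t,
    L (pure_ctx (f := fun k : copy => A (tag k))
         (fun k => sem_closed cofree atom (P (gamma k))) s)
    = sem_closed cofree atom (Q t)) ->
  exists f df, is_lift L f df.
Proof.
move=> pgt0; elim: s L => [|k s IHs] L.
  (* With no factors left [L] has one value to consider, a member of [Q]; [pgt0] supplies some
     [gamma] with which to read this off. *)
  move=> _ /(_ (fun k => pgt0 (tag k)))[t Lt].
  exists (cst (delta_mx 0 t)), (fun=> 0); split=> [w|v|w h|v _] /=.
  - exact: is_diff_cst.
  - by rewrite sem_comb_delta.
  - by rewrite linear0 sem_comb0.
  - exact: simplex_delta.
move=> /andP[ks us] LQ; pose i := tag k.
pose L1 j :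
    {linear sem_ctx cofree atom (copies_ctx A s) -> sem cofree atom B} :=
  L \o pure_left _ (sem_closed cofree atom (@P i j)).
have : forall j, exists fdf, is_lift (L1 j) fdf.1 fdf.2.
  move=> j; have [||f [df fP]] := IHs (L1 j); last by exists (f, df).
    by [].
  (* The choice [gamma] is overridden by [j] at [k] only; the tail is unaffected as [k] does not
     recur in [s]. *)
  move=> gamma; have [t Lt] := LQ (dfwith gamma k j); exists t.
  rewrite -Lt /= dfwithin; congr (L (pure _ _)).
  apply: pure_ctx_eq => l ls; rewrite dfwithout //.
  by apply: contraNneq ks => ->.
move=> /choice[F FP].
pose x (j : 'I_(p i)) (v : 'rV[R]_(\sum_i p i)) : R := v 0 (tagnat.Rank i j).
exists (fun v => \sum_j x j v *: (F j).1 v).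
exists (fun w h => \sum_j (x j w *: (F j).2 w h + x j h *: (F j).1 w)).
split=> [w|v|w h|v Sv].
- apply: is_diff_sum => j; apply: is_diff_scale; first exact: is_diff_coord.
  by have [] := FP j.
- rewrite sem_comb_sum /= linear_pure_comb; apply: eq_bigr => j _.
  by have [_ <-] := FP j.
- rewrite big_split sem_combD !sem_comb_sum /= linearD !linear_pure_comb addrC.
  by congr (_ + _); apply: eq_bigr => j _; have [_ fE dfE _] := FP j;
    rewrite -?dfE -?fE.
(* The [x j v] are the coordinates of the [i]-th component of [v], hence weights of a convex
   combination. *)
- have [x0 x1] := Sv i; apply: simplex_conv => [j||j].
  + by have := x0 j; rewrite mxE.
  + by rewrite -[RHS]x1; apply: eq_bigr => j _; rewrite mxE.
  + by have [_ _ _] := FP j; apply.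
Qed.

End Polynomial.

(** * Comparison of the polynomial map with the naive extension and its tangent map *)

Lemma copies_uniq r (n : 'I_r -> nat) : uniq (copies n).
Proof.
apply: allpairs_uniq_dep => [|i _|]; rewrite ?enum_uniq //.
by move=> [i j] [k l].
Qed.

Theorem theorem5p10 (R : realType)
    (cofree : forall V : lmodType R[i], cofree_coalgebra V)
    (atom : nat -> lmodType R[i])
    (r : nat) (A : 'I_r -> formula) (B : formula) (n : 'I_r -> nat)
    (pi : proof (copies_ctx A (copies n)) B)
    (psi : proof (bang_ctx A (enum 'I_r)) B)
    (psi_plain : plain_from pi psi)
    (p : 'I_r -> nat) (P : forall i, 'I_(p i) -> proof [::] (A i))
    (q : nat) (Q : 'I_q -> proof [::] B)
    (Q_independent : forall c : 'I_q -> R[i],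
      \sum_tau c tau *: sem_closed cofree atom (Q tau) = 0 ->
      forall tau, c tau = 0)
    (Q_contains : forall gamma : (forall k : {i : 'I_r & 'I_(n i)}, 'I_(p (tag k))),
      exists tau,
        sem_closed cofree atom (cut_all (fun k => P (tag k) (gamma k)) pi)
        = sem_closed cofree atom (Q tau))
    (w : 'rV[R]_(\sum_i p i)) (w_simplex : prod_simplex R p w)
    (i : 'I_r) (zeta rho : 'I_(p i)) :
  sem_proof cofree atom psi
    (pure_ctx
      (dfwith (vacua cofree atom P w) i
        (ket (cofree (sem cofree atom (A i)))
          (sem_comb cofree atom (P i) (submxrow w i))
          (sem_closed cofree atom (P i zeta) - sem_closed cofree atom (P i rho))
         : sem cofree atom (Bang (A i))))
      (enum 'I_r))
  = sem_comb cofree atom Q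
      (tangent_map (prod_simplex R p) (naive_extension cofree atom P Q psi) w
        (tangent_basis R zeta rho)).
Proof.
(* A simplex without vertices is empty, since an empty sum is not 1; so [w] forces each [p j] to be
   positive. *)
have pgt0 j : 'I_(p j).
  have [_] := w_simplex j; move: (submxrow w j).
  case: (p j) => [x|m _ _]; last exact: ord0.
  by rewrite big_ord0 => /esym/eqP; rewrite oner_eq0.
have piQ gamma : exists t,
    sem_proof cofree atom pi (pure_ctx (f := fun k => A (tag k))
      (fun k => sem_closed cofree atom (P (tag k) (gamma k))) (copies n))
    = sem_closed cofree atom (Q t).
  by have [t] := Q_contains gamma; rewrite sem_closed_cut_all; exists t.
have [f [df [f_diff fE dfE f_simplex]]] := exists_lift pgt0 (copies_uniq n) piQ.
pose g v := vacua cofree atom P v.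
pose comb j v := sem_comb cofree atom (P j) (submxrow v j).
pose d v h j : sem cofree atom (Bang (A j)) :=
  ket (cofree (sem cofree atom (A j))) (comb j v) (comb j h).
have der_g v : (fun k : {j : 'I_r & 'I_(n j)} =>
    dereliction (cofree (sem cofree atom (A (tag k)))) (g v (tag k)))
    = (fun k => comb (tag k) v).
  by apply: functional_extensionality_dep => k; exact: dereliction_vacuum.
have der_d v h : (fun k : {j : 'I_r & 'I_(n j)} =>
    dereliction (cofree (sem cofree atom (A (tag k)))) (d v h (tag k)))
    = (fun k => comb (tag k) h).
  by apply: functional_extensionality_dep => k; exact: dereliction_ket.
have g_comul v j := comul_vacuum (cofree (sem cofree atom (A j))) (comb j v).
have g_counit v j := counit_vacuum (cofree (sem cofree atom (A j))) (comb j v).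
have psiE v : sem_proof cofree atom psi (pure_ctx (g v) (enum 'I_r))
    = sem_comb cofree atom Q (f v).
  by rewrite (sem_plain (g_comul v) (g_counit v) psi_plain) der_g fE.
have naiveE v : prod_simplex R p v ->
    naive_extension cofree atom P Q psi v = f v.
  move=> Sv; apply: (sem_comb_inj Q_independent); rewrite -psiE.
  (* The default value 0 is never taken: [f v] satisfies the defining condition. *)
  rewrite /naive_extension; case: xgetP => [u _ [_ <-]//|].
  by move=> /(_ (f v)) []; split; [exact: f_simplex|exact: psiE].
set h := tangent_basis R zeta rho.
have -> : tangent_map (prod_simplex R p)
    (naive_extension cofree atom P Q psi) w h = df w h.
  (* [F] is an arbitrary choice among differentiable extensions; [f] shows that there is one, and
     then [F] and [f] have the same differential along [h]. *)
  rewrite /tangent_map; set S := [set F | _]; set F := xget _ _.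
  have [FE dF] : S F.
    apply: xgetPex.
    exists f; split; last exact: ex_diff.
    by move=> v /set_mem Sv; rewrite naiveE.
  rewrite (@diff_eq_on_prod_simplex _ _ _ _ F f) //; first by rewrite diff_val.
  by move=> v Sv; rewrite FE ?naiveE // inE.
(* Read backwards, the formal derivative of [pi] becomes [psi] on the Leibniz sum of kets in the
   directions given by the blocks of [h]. Only block [i] of [h] is nonzero. *)
rewrite -dfE -der_g -(der_d w h).
rewrite -(sem_plain_deriv (g_comul w) (g_counit w) _ _ psi_plain); last 2 first.
- by move=> j; exact: comul_ket.
- by move=> j; exact: counit_ket.
have combB : comb i h
    = sem_closed cofree atom (P i zeta) - sem_closed cofree atom (P i rho).
  by rewrite /comb submxrow_tangent_basis dfwithin sem_combB !sem_comb_delta.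
rewrite (@pure_ctx_deriv_dfwith _ _ _ _ _ _ _ _ i) ?enum_uniq ?mem_enum //.
  by rewrite /d combB.
move=> j ji; rewrite /d /comb submxrow_tangent_basis dfwithout 1?eq_sym //.
by rewrite sem_comb0 /ket (_ : prim_in 0 = 0) // linear0.
Qed.
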